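(* Let $\omega_s,\omega_a\in(0,2]$. Suppose that $$\omega_s\mathcal{L}_1\ \ge\ \max(0,\omega_s-1)$$ and that, for every $\ell\in\{1,\dots,W\}$, $$\omega_a\max_{u\in[-u_\infty,u_\infty]}\Bigl|\sum_{k=1}^d\mathcal{N}_{2\ell,k}\,\varphi_k'(u)\Bigr|\ \le\ \omega_s\mathcal{L}_{2\ell}+\tfrac12\min\bigl(2-\omega_s-\omega_a,\ 0,\ \omega_a-\omega_s\bigr).$$ Then the relaxation operator $\mathcal{R}=(\mathcal{R}_1,\dots,\mathcal{R}_q):\mathbb{R}^q\to\mathbb{R}^q$ is monotone non-decreasing over $K$.
   Context: Setting. Let $d,W\ge 1$ be integers, $q=1+2W$, $\lambda>0$. Discrete velocities: $c_1=0$ and $c_{2\ell}=-c_{2\ell+1}\in\lambda\mathbb{Z}^d$ for $\ell=1,\dots,W$; $c_{i,k}$ is the $k$-th component of $c_i$. Fluxes $\varphi_k\in C^1(\mathbb{R})$, $k=1,\dots,d$, are non-constant with $\varphi_k(0)=0$. The initial datum is $u^\circ\in L^1(\mathbb{R}^d)\cap L^\infty(\mathbb{R}^d)\cap BV(\mathbb{R}^d)$ and $u_\infty:=\|u^\circ\|_{L^\infty}$. Equilibria: $f_i^{\rm eq}:\mathbb{R}\to\mathbb{R}$, $f_i^{\rm eq}(u)=\mathcal{L}_i u+\sum_{k=1}^d\mathcal{N}_{i,k}\varphi_k(u)$, $i=1,\dots,q$, with real coefficients satisfying $\mathcal{L}_{2\ell}=\mathcal{L}_{2\ell+1}$, $\mathcal{N}_{2\ell,k}=-\mathcal{N}_{2\ell+1,k}\ge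 0$, $\mathcal{L}_1+2\sum_{\ell=1}^W\mathcal{L}_{2\ell}=1$, $\mathcal{N}_{1,k}=0$, and $2\sum_{\ell=1}^W c_{2\ell,k}\mathcal{N}_{2\ell,p}=\delta_{k,p}$ for all $k,p\in\{1,\dots,d\}$. Relaxation operator: for $f=(f_1,\dots,f_q)\in\mathbb{R}^q$ set $u=\sum_{i=1}^q f_i$ and $\mathcal{R}_1(f)=(1-\omega_s)f_1+\omega_s f_1^{\rm eq}(u)$, $\mathcal{R}_{2\ell}(f)=\bigl(1-\tfrac12(\omega_s+\omega_a)\bigr)f_{2\ell}+\tfrac12(\omega_s+\omega_a)f_{2\ell}^{\rm eq}(u)-\tfrac12(\omega_s-\omega_a)\bigl(f_{2\ell+1}-f_{2\ell+1}^{\rm eq}(u)\bigr)$, $\mathcal{R}_{2\ell+1}(f)=\bigl(1-\tfrac12(\omega_s+\omega_a)\bigr)f_{2\ell+1}+\tfrac12(\omega_s+\omega_a)f_{2\ell+1}^{\rm eq}(u)-\tfrac12(\omega_s-\omega_a)\bigl(f_{2\ell}-f_{2\ell}^{\rm eq}(u)\bigr)$, for $\ell=1,\dots,W$. Compact set: $K:=\prod_{i=1}^q[f_i^{\rm eq}(-u_\infty),f_i^{\rm eq}(u_\infty)]$. $\mathcal{R}$ is called monotone non-decreasing over $K$ if, on $K$, each component $\mathcal{R}_i$ is non-decreasing with respect to each of its arguments $f_1,\dots,f_q$ (since $\mathcal{R}$ is $C^1$, this amounts to its Jacobian matrix having only non-negative entries at every point of $K$). *)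

(* Defs.v *)
From HB Require Import structures.
From mathcomp Require Import all_boot all_order all_algebra.
From mathcomp Require Import all_classical all_reals all_analysis.

Set Implicit Arguments.
Unset Strict Implicit.
Unset Printing Implicit Defensive.

Import Order.TTheory GRing.Theory Num.Theory.
Import numFieldNormedType.Exports.

Local Open Scope classical_set_scope.
Local Open Scope ring_scope.

(* Lebesgue measure on R^d, on the product (= Borel) sigma-algebra of
   d.-tuple R: a recursion on d, pushing lebesgue_measure \x (previous measure)
   forward along (x, t) |-> x :: t. *)
Section lebesgue_cons.
Context (R : realType) (n : nat).
Variable m : {sigma_finite_measure set (n.-tuple R) -> \bar R}.

Definition tuple_cons (p : R * n.-tuple R) : n.+1.-tuple R :=
  [the n.+1.-tuple R of p.1 :: p.2].

Lemma measurable_tuple_cons : measurable_fun [set: R * n.-tuple R] tuple_cons.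
Proof. exact: measurable_cons. Qed.

Definition lebesgue_cons : set (n.+1.-tuple R) -> \bar R :=
  pushforward (product_measure1 (@lebesgue_measure R) m) tuple_cons.

Local Open Scope ereal_scope.

Let lebesgue_cons0 : lebesgue_cons set0 = 0.
Proof. by rewrite /lebesgue_cons /pushforward preimage_set0 measure0. Qed.

Let lebesgue_cons_ge0 A : 0 <= lebesgue_cons A.
Proof. by rewrite /lebesgue_cons /pushforward; exact: measure_ge0. Qed.

Let lebesgue_cons_sigma_additive : semi_sigma_additive lebesgue_cons.
Proof.
move=> F mF tF mUF; rewrite /lebesgue_cons /pushforward preimage_bigcup.
apply: measure_semi_sigma_additive.
- move=> k; rewrite -[X in measurable X]setTI.
  exact: measurable_tuple_cons.
- apply/trivIsetP => /= i j _ _ ij; rewrite -preimage_setI.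
  by move/trivIsetP : tF => /(_ _ _ _ _ ij) ->//; rewrite preimage_set0.
- rewrite -preimage_bigcup -[X in measurable X]setTI.
  exact: measurable_tuple_cons.
Qed.

HB.instance Definition _ := isMeasure.Build _ _ _ lebesgue_cons
  lebesgue_cons0 lebesgue_cons_ge0 lebesgue_cons_sigma_additive.

Lemma lebesgue_cons_preimage (A : set R) (B : set (n.-tuple R)) :
  measurable A -> measurable B ->
  lebesgue_cons [set t | A (thead t) /\ B [tuple of behead t]] =
  lebesgue_measure A * m B.
Proof.
move=> mA mB; rewrite -product_measure1E// /lebesgue_cons /pushforward.
congr (product_measure1 _ _ _); apply/funext => -[x t] /=.
have bE : [tuple of behead (tuple_cons (x, t))] = t by exact: val_inj.
by rewrite /preimage /setX /= bE.
Qed.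

Let lebesgue_cons_sigma_finite : sigma_finite setT lebesgue_cons.
Proof.
have /sigma_finiteP[F [FT ndF Foo]] := sigma_finiteT (@lebesgue_measure R).
have /sigma_finiteP[G [GT ndG Goo]] := sigma_finiteT m.
exists (fun k => [set t | F k (thead t) /\ G k [tuple of behead t]]).
  apply/seteqP; split => // t _.
  have [i _ Fi] : (\bigcup_i F i) (thead t) by rewrite -FT.
  have [j _ Gj] : (\bigcup_i G i) [tuple of behead t] by rewrite -GT.
  exists (maxn i j) => //=; split.
    by move: Fi; exact/subsetPset/ndF/leq_maxl.
  by move: Gj; exact/subsetPset/ndG/leq_maxr.
move=> k; have [mF Fk] := Foo k; have [mG Gk] := Goo k; split.
  apply: measurableI; rewrite -[X in measurable X]setTI.
    exact: (measurable_tnth ord0).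
  exact: measurable_behead.
by rewrite lebesgue_cons_preimage// lte_mul_pinfty// ge0_fin_numE.
Qed.

HB.instance Definition _ := Measure_isSigmaFinite.Build _ _ _ lebesgue_cons
  lebesgue_cons_sigma_finite.

End lebesgue_cons.

Fixpoint lebesgue_tuple (R : realType) (d : nat) :
    {sigma_finite_measure set (d.-tuple R) -> \bar R} :=
  match d with
  | 0 => [the {sigma_finite_measure set (0.-tuple R) -> \bar R} of
            dirac [tuple]]
  | n.+1 => [the {sigma_finite_measure set (n.+1.-tuple R) -> \bar R} of
            lebesgue_cons (lebesgue_tuple R n)]
  end.

Lemma lebesgue_tuple_box (R : realType) (d : nat) (A : 'I_d -> set R) :
  (forall i, measurable (A i)) ->
  lebesgue_tuple R d [set t | forall i, A i (tnth t i)] =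
  (\prod_(i < d) lebesgue_measure (A i))%E.
Proof.
elim: d A => [|n IH] A mA.
  by rewrite big_ord0 /= diracE mem_set// => -[].
have mB : measurable [set t : n.-tuple R | forall i, A (lift ord0 i) (tnth t i)].
  rewrite (_ : [set _ | _] = \bigcap_(i in [set: 'I_n])
      ((fun t : n.-tuple R => tnth t i) @^-1` A (lift ord0 i))).
    apply: fin_bigcap_measurable => // i _; rewrite -[X in measurable X]setTI.
    by apply: measurable_tnth.
  by apply/seteqP; split => t /= At i; [move=> _; exact: At | exact: (At i I)].
rewrite big_ord_recl -(IH (fun i => A (lift ord0 i)))//.
rewrite -[RHS](lebesgue_cons_preimage _ (mA ord0) mB) /=; congr lebesgue_cons.
have tE (t : n.+1.-tuple R) i :
    tnth t (lift ord0 i) = tnth [tuple of behead t] i.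
  by rewrite {1}(tuple_eta t) tnthS.
apply/seteqP; split => t /= => [At|[At0 At] i].
  by split=> [|i]; [exact: At | rewrite -tE; exact: At].
by case: (unliftP ord0 i) => [j ->|-> //]; rewrite tE; exact: At.
Qed.

(* The canonical identification of d.-tuple R, which carries the measurable
   structure, with 'rV[R]_d, which carries the topology and the derivatives. *)
Definition row_of_tuple (R : realType) (d : nat) (t : d.-tuple R) : 'rV[R]_d :=
  \row_i tnth t i.

Section function_spaces.
Context (R : realType) (d : nat).
Local Notation mu := (lebesgue_tuple R d).
Implicit Type u : 'rV[R]_d -> R.

Definition measurable_on_Rd u :=
  measurable_fun [set: d.-tuple R] (u \o @row_of_tuple R d).

Definition in_L1 u :=
  measurable_on_Rd u /\ finite_norm mu 1%E (u \o @row_of_tuple R d).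

Definition in_Linfty u :=
  measurable_on_Rd u /\ finite_norm mu +oo%E (u \o @row_of_tuple R d).

Definition Linfty_norm u : R :=
  fine ('N[mu]_+oo%E [EFin \o (u \o @row_of_tuple R d)])%E.

Definition ebasis (i : 'I_d) : 'rV[R]_d := delta_mx 0 i.

Definition C1_field (psi : 'rV[R]_d -> 'rV[R]_d) :=
  forall i : 'I_d, (forall x, derivable psi x (ebasis i)) /\
                   continuous (fun x => 'D_(ebasis i) psi x).

Definition compactly_supported (psi : 'rV[R]_d -> 'rV[R]_d) :=
  compact (closure [set x | psi x != 0]).

Definition divergence (psi : 'rV[R]_d -> 'rV[R]_d) (x : 'rV[R]_d) : R :=
  \sum_(i < d) ('D_(ebasis i) psi x) 0 i.

(* The pointwise constraint on the test fields is in the Euclidean norm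
   (`|psi x| would be the maximum norm). *)
Definition total_variation u : \bar R :=
  ereal_sup [set (\int[mu]_t (u (row_of_tuple t) *
                               divergence psi (row_of_tuple t))%:E)%E
            | psi in [set psi | [/\ C1_field psi, compactly_supported psi &
                forall x, \sum_(i < d) psi x 0 i ^+ 2 <= 1]]].

Definition in_BV u := in_L1 u /\ (total_variation u < +oo)%E.

End function_spaces.

Definition C1_function (R : realType) (g : R -> R) :=
  (forall x, derivable g x 1) /\ continuous (derive1 g).

(* 0-based indices: the velocity index i in {1, .., q} of the text is i.-1 here,
   and l in {1, .., W} is l.-1 : 'I_W. *)
Definition nvel (W : nat) : nat := (1 + 2 * W)%N.

Lemma idx_even_subproof (W : nat) (l : 'I_W) : (2 * l + 1 < nvel W)%N.
Proof. by rewrite /nvel addnC ltn_add2l ltn_pmul2l. Qed.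

Lemma idx_odd_subproof (W : nat) (l : 'I_W) : (2 * l + 2 < nvel W)%N.
Proof. by rewrite /nvel add1n ltnS -{2}[2%N]muln1 -mulnDr addn1 leq_pmul2l. Qed.

(* Text indices 1, 2l and 2l+1. *)
Definition idx_one (W : nat) : 'I_(nvel W) := @Ordinal (nvel W) 0 isT.
Definition idx_even (W : nat) (l : 'I_W) : 'I_(nvel W) :=
  Ordinal (idx_even_subproof l).
Definition idx_odd (W : nat) (l : 'I_W) : 'I_(nvel W) :=
  Ordinal (idx_odd_subproof l).

(* Exchanges the text indices 2l and 2l+1, and fixes 1. *)
Definition partner_nat (i : nat) : nat :=
  if i == 0%N then 0%N else if odd i then i.+1 else i.-1.

Lemma partner_subproof (W : nat) (i : 'I_(nvel W)) :
  (partner_nat i < nvel W)%N.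
Proof.
rewrite /partner_nat; case: i => -[//|i] ilt; rewrite [nat_of_ord _]/= [_ == 0%N]/=.
case: ifPn => [oddi|_]; last exact: ltn_trans ilt.
move: ilt; rewrite /nvel !add1n !ltnS leq_eqVlt => /orP[/eqP iE|//].
by move: oddi; rewrite iE mul2n odd_double.
Qed.

Definition partner (W : nat) (i : 'I_(nvel W)) : 'I_(nvel W) :=
  Ordinal (partner_subproof i).

Lemma partner_even (W : nat) (l : 'I_W) : partner (idx_even l) = idx_odd l.
Proof.
apply: val_inj; rewrite /= /partner_nat addn1 /= mul2n odd_double /=.
by rewrite addn2.
Qed.

Lemma partner_odd (W : nat) (l : 'I_W) : partner (idx_odd l) = idx_even l.
Proof.
apply: val_inj; rewrite /= /partner_nat addn2 /= mul2n odd_double /=.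
by rewrite addn1.
Qed.

Section relaxation.
Context (R : realType) (d W : nat).
Variables (L : 'I_(nvel W) -> R) (N : 'I_(nvel W) -> 'I_d -> R).
Variable phi : 'I_d -> R -> R.

Definition feq (i : 'I_(nvel W)) (u : R) : R :=
  L i * u + \sum_(k < d) N i k * phi k u.

Definition relax (omega_s omega_a : R) (f : 'rV[R]_(nvel W)) :
    'rV[R]_(nvel W) :=
  let u := \sum_i f 0 i in
  \row_i
    if i == idx_one W then (1 - omega_s) * f 0 i + omega_s * feq i u
    else (1 - (omega_s + omega_a) / 2) * f 0 i
         + (omega_s + omega_a) / 2 * feq i u
         - (omega_s - omega_a) / 2 * (f 0 (partner i) - feq (partner i) u).

Lemma relax_one omega_s omega_a (f : 'rV[R]_(nvel W)) (u := \sum_i f 0 i) :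
  relax omega_s omega_a f 0 (idx_one W) =
  (1 - omega_s) * f 0 (idx_one W) + omega_s * feq (idx_one W) u.
Proof. by rewrite mxE eqxx. Qed.

Lemma relax_even omega_s omega_a (f : 'rV[R]_(nvel W)) (l : 'I_W)
    (u := \sum_i f 0 i) :
  relax omega_s omega_a f 0 (idx_even l) =
  (1 - (omega_s + omega_a) / 2) * f 0 (idx_even l)
  + (omega_s + omega_a) / 2 * feq (idx_even l) u
  - (omega_s - omega_a) / 2 * (f 0 (idx_odd l) - feq (idx_odd l) u).
Proof.
by rewrite mxE ifF ?partner_even// -val_eqE /= addn1.
Qed.

Lemma relax_odd omega_s omega_a (f : 'rV[R]_(nvel W)) (l : 'I_W)
    (u := \sum_i f 0 i) :
  relax omega_s omega_a f 0 (idx_odd l) =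
  (1 - (omega_s + omega_a) / 2) * f 0 (idx_odd l)
  + (omega_s + omega_a) / 2 * feq (idx_odd l) u
  - (omega_s - omega_a) / 2 * (f 0 (idx_even l) - feq (idx_even l) u).
Proof.
by rewrite mxE ifF ?partner_odd// -val_eqE /= addn2.
Qed.

Definition Kset (uinf : R) : set 'rV[R]_(nvel W) :=
  [set f | forall i, feq i (- uinf) <= f 0 i <= feq i uinf].

End relaxation.

Definition monotone_nondecreasing_on (R : realType) (q : nat)
    (K : set 'rV[R]_q) (F : 'rV[R]_q -> 'rV[R]_q) : Prop :=
  forall (i j : 'I_q) (f g : 'rV[R]_q), K f -> K g ->
    (forall k, k != j -> f 0 k = g 0 k) -> f 0 j <= g 0 j ->
    F f 0 i <= F g 0 i.

(* Main.v *)
(* On [K] the sum [u] stays in [-uinf, uinf], because the equilibria sum to the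
   identity.  When [f_j] grows by [h >= 0] so does [u]; by the mean value theorem
   the flux part of the equilibrium [2l] then moves by at most [B h], with [B] the
   maximum in the hypothesis.  In the relaxed component [2l] (or [2l+1]) the
   equilibria recombine into [omega_s L_{2l} h +- omega_a (flux variation)], and
   the three entries of the minimum pay for the linear coefficients of the cases
   [j = i], [j] unrelated to [i], and [j] the partner of [i]. *)
Require Import Defs.
From HB Require Import structures.
From mathcomp Require Import all_boot all_order all_algebra.
From mathcomp Require Import all_classical all_reals all_analysis.
From mathcomp Require Import zify ring lra.

Set Implicit Arguments.
Unset Strict Implicit.
Unset Printing Implicit Defensive.

Import Order.TTheory GRing.Theory Num.Theory.
Import numFieldNormedType.Exports.

Local Open Scope classical_set_scope.
Local Open Scope ring_scope.

(* [nvel W] and [idx_*] are ordinals given by parity, hence the detour through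
   the natural-number sum. *)
Lemma big_nvel (V : nmodType) (W : nat) (F : 'I_(nvel W) -> V) :
  \sum_i F i =
  F (idx_one W) + \sum_(l < W) (F (idx_even l) + F (idx_odd l)).
Proof.
have natE n (G : nat -> V) : \sum_(i < (1 + 2 * n)%N) G i =
    G 0%N + \sum_(l < n) (G (2 * l + 1)%N + G (2 * l + 2)%N).
  elim: n => [|n IHn]; first by rewrite muln0 big_ord_recr !big_ord0 addrC.
  rewrite (_ : (1 + 2 * n.+1)%N = (1 + 2 * n).+2); last by rewrite mulnS.
  rewrite 2!big_ord_recr IHn [in RHS]big_ord_recr /= !addrA.
  by rewrite addn2 addn1 add1n.
have := natE W (fun i => F (inord i)).
have inE (i : 'I_(nvel W)) : inord i = i by exact: inord_val.
under eq_bigr do rewrite inE.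
move=> ->; congr (F _ + _); first by apply: val_inj; rewrite /= inordK.
by apply: eq_bigr => l _; rewrite -(inE (idx_even l)) -(inE (idx_odd l)).
Qed.

Variant nvel_spec (W : nat) : 'I_(nvel W) -> Type :=
  | NvelOne : nvel_spec (idx_one W)
  | NvelEven (l : 'I_W) : nvel_spec (idx_even l)
  | NvelOdd (l : 'I_W) : nvel_spec (idx_odd l).

Lemma nvelP (W : nat) (i : 'I_(nvel W)) : nvel_spec i.
Proof.
case: i => -[|i] ilt.
  by rewrite (_ : Ordinal ilt = idx_one W); [constructor | exact: val_inj].
have lW : (i./2 < W)%N by move: ilt; rewrite /nvel; lia.
(* Here the index is [i.+1], so the parity of [i] is opposite to its own: [i] odd gives
   [2 * i./2 + 2]. *)
case: (boolP (odd i)) => oi.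
  rewrite (_ : Ordinal ilt = idx_odd (Ordinal lW)); first by constructor.
  by apply: val_inj => /=; move: oi; lia.
rewrite (_ : Ordinal ilt = idx_even (Ordinal lW)); first by constructor.
by apply: val_inj => /=; move: oi; lia.
Qed.

Section lipschitz.
Context (R : realType).
Implicit Types (G g : R -> R) (a b x y : R).

(** The extreme value theorem bounds the set above, so that [sup] really is an upper bound and not a
    default value. *)
Lemma le_sup_norm_itv g a b x : continuous g -> a <= x <= b ->
  `|g x| <= sup [set `|g u| | u in `[a, b]%classic].
Proof.
move=> cg axb; have /andP[ax xb] := axb.
have cng : {within `[a, b], continuous (fun u => `|g u|)}.
  apply: continuous_subspaceT => u.
  by apply: continuous_comp; [exact: cg | exact: norm_continuous].
have [m _ mE] := EVT_max (le_trans ax xb) cng.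
apply: ub_le_sup; last by exists x => //=; rewrite in_itv.
by exists `|g m| => _ [u uab <-]; exact: mE.
Qed.

(** Mean value theorem on [[x, y]]; the supremum runs over the larger [[a, b]] so that the constant
    does not depend on [x] and [y]. *)
Lemma lipschitz_sup_norm G g a b x y :
  (forall u : R, is_derive u 1 G (g u)) -> continuous g ->
  a <= x -> x <= y -> y <= b ->
  `|G y - G x| <= sup [set `|g u| | u in `[a, b]%classic] * (y - x).
Proof.
move=> dG cg ax xy yb.
have cG : {within `[x, y], continuous G}.
  apply: continuous_subspaceT => u; apply: differentiable_continuous.
  by apply/derivable1_diffP; have [] := dG u.
have [m /[!in_itv] /andP[xm my] ->] := MVT_segment xy (fun u _ => dG u) cG.
rewrite normrM (ger0_norm (_ : 0 <= y - x)) ?subr_ge0//.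
rewrite ler_wpM2r ?subr_ge0// le_sup_norm_itv//.
by rewrite (le_trans ax xm) (le_trans my yb).
Qed.

End lipschitz.

Section equilibria.
Context (R : realType) (d W : nat).
Variables (L : 'I_(nvel W) -> R) (N : 'I_(nvel W) -> 'I_d -> R).
Variable phi : 'I_d -> R -> R.
Hypothesis L_sym : forall l : 'I_W, L (idx_even l) = L (idx_odd l).
Hypothesis N_antisym : forall (l : 'I_W) (k : 'I_d),
  N (idx_even l) k = - N (idx_odd l) k.

(** Both equilibria of a pair are thus written with the same flux sum, up to its sign. *)
Lemma feq_idx_odd (l : 'I_W) u :
  feq L N phi (idx_odd l) u =
  L (idx_even l) * u - \sum_(k < d) N (idx_even l) k * phi k u.
Proof.
rewrite /feq -L_sym -sumrN; congr (_ + _); apply: eq_bigr => k _.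
by rewrite N_antisym mulNr opprK.
Qed.

Lemma feq_idx_one u : (forall k, N (idx_one W) k = 0) ->
  feq L N phi (idx_one W) u = L (idx_one W) * u.
Proof.
by move=> N1; rewrite /feq big1 ?addr0// => k _; rewrite N1 mul0r.
Qed.

(** The flux parts cancel within each pair, and the linear coefficients add up to 1. *)
Lemma sum_feq u : (forall k, N (idx_one W) k = 0) ->
  L (idx_one W) + 2 * \sum_(l < W) L (idx_even l) = 1 ->
  \sum_i feq L N phi i u = u.
Proof.
move=> N1 L1; rewrite big_nvel feq_idx_one// -[RHS]mul1r -L1 mulrDl.
rewrite -mulrA mulr_suml mulr_sumr; congr (_ + _); apply: eq_bigr => l _.
by rewrite feq_idx_odd /feq; ring.
Qed.

Lemma Kset_sum uinf (f : 'rV[R]_(nvel W)) : (forall k, N (idx_one W) k = 0) ->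
  L (idx_one W) + 2 * \sum_(l < W) L (idx_even l) = 1 ->
  Kset L N phi uinf f -> - uinf <= \sum_i f 0 i <= uinf.
Proof.
move=> N1 L1 Kf; rewrite -{1}(sum_feq (- uinf) N1 L1) -{2}(sum_feq uinf N1 L1).
by apply/andP; split; apply: ler_sum => i _; have /andP[] := Kf i.
Qed.

End equilibria.

(** The mean value theorem is applied to the whole combination, since the supremum is that of the
    absolute value of a sum, not of a sum of absolute values. *)
Lemma lipschitz_flux (R : realType) (d : nat) (n : 'I_d -> R)
    (phi : 'I_d -> R -> R) (a b x y : R) :
  (forall k, C1_function (phi k)) -> a <= x -> x <= y -> y <= b ->
  `|\sum_(k < d) n k * phi k y - \sum_(k < d) n k * phi k x| <=
  sup [set `|\sum_(k < d) n k * derive1 (phi k) u| | u in `[a, b]%classic]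
    * (y - x).
Proof.
move=> C1 ax xy yb.
apply: (lipschitz_sup_norm (G := fun u => \sum_(k < d) n k * phi k u)
  (g := fun u => \sum_(k < d) n k * derive1 (phi k) u)) => // u.
  rewrite (_ : (fun _ => _) = \sum_(k < d) (n k *: phi k)); last first.
    by apply/funext => v; rewrite fct_sumE.
  apply: is_derive_sum => k; apply: is_deriveZ.
  rewrite derive1E; apply: DeriveDef => //.
  by have [dphi _] := C1 k; exact: dphi.
apply: cvg_big => [|k _]; first exact: add_continuous.
apply: cvgM; first exact: cvg_cst.
by have [_ cphi] := C1 k; exact: cphi.
Qed.

Theorem proposition3p3 (R : realType) (d W : nat) (d_ge1 : (1 <= d)%N)
  (W_ge1 : (1 <= W)%N) (lambda : R) (lambda_gt0 : 0 < lambda)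
  (c : 'I_(nvel W) -> 'rV[R]_d)
  (c_one : c (idx_one W) = 0)
  (c_opp : forall l : 'I_W, c (idx_even l) = - c (idx_odd l))
  (c_lattice : forall (l : 'I_W) (k : 'I_d),
     exists z : int, c (idx_even l) 0 k = lambda * z%:~R)
  (phi : 'I_d -> R -> R)
  (phi_C1 : forall k, C1_function (phi k))
  (phi_nonconstant : forall k, ~ (exists a : R, forall u, phi k u = a))
  (phi_0 : forall k, phi k 0 = 0)
  (u0 : 'rV[R]_d -> R)
  (u0_L1 : in_L1 u0) (u0_Linfty : in_Linfty u0) (u0_BV : in_BV u0)
  (L : 'I_(nvel W) -> R) (N : 'I_(nvel W) -> 'I_d -> R)
  (L_sym : forall l : 'I_W, L (idx_even l) = L (idx_odd l))
  (N_antisym : forall (l : 'I_W) (k : 'I_d),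
     N (idx_even l) k = - N (idx_odd l) k)
  (N_ge0 : forall (l : 'I_W) (k : 'I_d), 0 <= N (idx_even l) k)
  (L_sum : L (idx_one W) + 2 * \sum_(l < W) L (idx_even l) = 1)
  (N_one : forall k : 'I_d, N (idx_one W) k = 0)
  (N_flux : forall k p : 'I_d,
     2 * \sum_(l < W) c (idx_even l) 0 k * N (idx_even l) p = (k == p)%:R)
  (omega_s omega_a : R)
  (omega_s_range : 0 < omega_s <= 2) (omega_a_range : 0 < omega_a <= 2)
  (cond_one : Num.max 0 (omega_s - 1) <= omega_s * L (idx_one W))
  (cond_pairs : forall l : 'I_W,
     omega_a * sup [set `|\sum_(k < d) N (idx_even l) k * derive1 (phi k) u|
                   | u in `[- Linfty_norm u0, Linfty_norm u0]%classic]
     <= omega_s * L (idx_even l)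
        + 1 / 2 * Num.min (Num.min (2 - omega_s - omega_a) 0)
                          (omega_a - omega_s)) :
  monotone_nondecreasing_on (Kset L N phi (Linfty_norm u0))
    (relax L N phi omega_s omega_a).
Proof.
move=> i j f g Kf Kg fgE fgj.
have /andP[u_ge _] := Kset_sum L_sym N_antisym N_one L_sum Kf.
have /andP[_ v_le] := Kset_sum L_sym N_antisym N_one L_sum Kg.
have vu : \sum_k g 0 k - \sum_k f 0 k = g 0 j - f 0 j.
  rewrite (bigD1 j)//= [X in _ - X](bigD1 j)//= opprD addrACA.
  rewrite [X in _ + X](_ : _ = 0) ?addr0//; apply/eqP; rewrite subr_eq0.
  by apply/eqP/eq_bigr => k /fgE ->.
have uv : \sum_k f 0 k <= \sum_k g 0 k by rewrite -subr_ge0 vu subr_ge0.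
have key l := lipschitz_flux (N (idx_even l)) phi_C1 u_ge uv v_le.
have feqE l u : feq L N phi (idx_even l) u =
  L (idx_even l) * u + \sum_(k < d) N (idx_even l) k * phi k u by [].
have feqO := feq_idx_odd phi L_sym N_antisym.
have feq1 u := feq_idx_one L phi u N_one.
have idx_even_odd l m : idx_even l != idx_odd m :> 'I_(nvel W).
  by rewrite -val_eqE /=; lia.
have h_ge0 : 0 <= g 0 j - f 0 j by rewrite subr_ge0.
move: vu uv key.
set u := \sum_k f 0 k; set v := \sum_k g 0 k => vu uv key.
move: vu h_ge0; set h := g 0 j - f 0 j => vu h_ge0.
have vE : v = u + h by rewrite -vu addrC subrK.
(* The indicator of [k == j] lets one formula cover all positions of [j]. *)
have fg k : f 0 k + (k == j)%:R * h = g 0 k.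
  case: eqVneq => [->|/fgE ->]; last by rewrite mul0r addr0.
  by rewrite mul1r /h addrC subrK.
have [/andP[ws0 ws2] /andP[wa0 wa2]] := (omega_s_range, omega_a_range).
(* [e] and [o] tell whether [j] is the component under study or its partner. The flux variation
   enters through its absolute value, so the bound serves both members of the pair. *)
have pair_bound l (G G' : R)
    (B := sup [set `|\sum_(k < d) N (idx_even l) k * derive1 (phi k) u|
              | u in `[- Linfty_norm u0, Linfty_norm u0]%classic])
    (e o : bool) : `|G' - G| <= B * h -> ~~ (e && o) ->
  0 <= omega_s * (L (idx_even l) * h)
       + (1 - (omega_s + omega_a) / 2) * (e%:R * h)
       - (omega_s - omega_a) / 2 * (o%:R * h) - omega_a * `|G' - G|.
  move=> GB eo.
  have condB := cond_pairs l; rewrite -/B in condB.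
  set m := Num.min _ _ in condB.
  have [m1 m2 m3] : [/\ m <= 2 - omega_s - omega_a, m <= 0
      & m <= omega_a - omega_s].
    by split; rewrite /m !ge_min lexx ?orbT.
  have H1 : omega_a * `|G' - G| <= (omega_a * B) * h.
    by rewrite -mulrA ler_pM2l.
  (* Multiplying by [h] beforehand leaves only inequalities linear in the monomials, within reach of
     [lra]. *)
  have H2 := ler_wpM2r h_ge0 condB.
  have K1 := ler_wpM2r h_ge0 m1.
  have K2 := ler_wpM2r h_ge0 m2.
  have K3 := ler_wpM2r h_ge0 m3.
  by case: e o eo => -[]//= _; lra.
case: (nvelP i) => [|l|l].
- rewrite !relax_one -/u -/v !feq1 -fg vE.
  (* [c0] settles [j] different from [idx_one W], [c1] settles equality. *)
  have [c0 c1] : 0 <= omega_s * L (idx_one W) /\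
      omega_s - 1 <= omega_s * L (idx_one W).
    by move: cond_one; rewrite ge_max => /andP.
  have H0 := ler_wpM2r h_ge0 c0; have H1 := ler_wpM2r h_ge0 c1.
  by case: eqP => _ /=; lra.
- have := key l; rewrite vu => /pair_bound.
  move=> /(_ (idx_even l == j) (idx_odd l == j)).
  rewrite !relax_even -/u -/v !feqO !feqE -!fg.
  set G := \sum_(k < d) _ * phi k u; set G' := \sum_(k < d) _ * phi k v.
  (* The two equilibria of the pair recombine into [+ omega_a * (G' - G)], whose worst case is minus
     the absolute value. *)
  have P1 : 0 <= omega_a * (`|G' - G| + (G' - G)).
    by rewrite mulr_ge0 ?(ltW wa0)// -[X in _ + X]opprK subr_ge0 -normrN ler_norm.
  have -> : ~~ ((idx_even l == j) && (idx_odd l == j)).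
    by apply/negP => /andP[/eqP <-]; rewrite eq_sym (negbTE (idx_even_odd _ _)).
  by rewrite vE => /(_ isT); lra.
- have := key l; rewrite vu => /pair_bound.
  move=> /(_ (idx_odd l == j) (idx_even l == j)).
  rewrite !relax_odd -/u -/v !feqO !feqE -!fg.
  set G := \sum_(k < d) _ * phi k u; set G' := \sum_(k < d) _ * phi k v.
  (* In the odd component the flux variation comes with the opposite sign. *)
  have P1 : 0 <= omega_a * (`|G' - G| - (G' - G)).
    by rewrite mulr_ge0 ?(ltW wa0)// subr_ge0 ler_norm.
  have -> : ~~ ((idx_odd l == j) && (idx_even l == j)).
    by apply/negP => /andP[/eqP <-]; rewrite (negbTE (idx_even_odd _ _)).
  by rewrite vE => /(_ isT); lra.
Qed.
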